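(* Let $a,b,c\in\mathbb C$ with $c\notin\mathbb Z$. Then, as power series in $t$, $$F(a,b,c;t)F(-a,-b-2,-c;t)+\frac{2ab}{c(c-2)}\,t\,F(a+1,b+1,c+1;t)F(-a,-b-2,-c;t)$$ $$+\frac{(a)_2(b)_2}{(c-2)_4}\,t^2\,F(a+2,b+2,c+2;t)F(-a,-b-2,-c;t)$$ $$+\frac{a\,(b)_3\,(a-c)_3\,(c-b-2)}{(c-3)_4\,(c-2)_4}\,t^4\,F(a-c+3,b-c+3,4-c;t)F(-a+c+1,-b+c-1,c+2;t)$$ $$=1+\frac{2a(b-c+2)}{c(c-2)}\,t+\frac{a(a-b-1)(c-b-2)}{(c-2)(c-1)c}\,t^2 .$$
   Context: $F(a,b,c;t)={}_2F_1(a,b,c;t)=\sum_{n\ge0}\frac{(a)_n(b)_n}{n!\,(c)_n}t^n$ is the Gauss hypergeometric series, with $(a)_n=a(a+1)\cdots(a+n-1)$. *)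

(* Defs.v *)
From HB Require Import structures.
From mathcomp Require Import all_boot all_order all_algebra.
From mathcomp Require Import reals.
From mathcomp.real_closed Require Export complex.

Set Implicit Arguments.
Unset Strict Implicit.
Unset Printing Implicit Defensive.

Import GRing.Theory.
Local Open Scope ring_scope.

(* Formal power series in one variable t, given by their coefficients. *)
Definition fps (K : Type) : Type := nat -> K.

Declare Scope fps_scope.
Delimit Scope fps_scope with fps.
Bind Scope fps_scope with fps.

Definition fps_add (K : nzRingType) (f g : fps K) : fps K :=
  fun n => f n + g n.

Definition fps_mul (K : nzRingType) (f g : fps K) : fps K :=
  fun n => \sum_(i < n.+1) f i * g (n - i)%N.

Definition fps_of_poly (K : nzRingType) (p : {poly K}) : fps K :=
  fun n => p`_n.

Notation "f + g" := (fps_add f%fps g%fps) : fps_scope.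
Notation "f * g" := (fps_mul f%fps g%fps) : fps_scope.
Notation "p %:S" := (fps_of_poly p%R)
  (at level 1, left associativity, format "p %:S") : fps_scope.

(* (a)_n = a (a + 1) ... (a + n - 1) *)
Definition poch (K : nzRingType) (a : K) (n : nat) : K :=
  \prod_(i < n) (a + i%:R).

(* Since x / 0 = 0 here, this is the usual series only when c is not a
   nonpositive integer. *)
Definition hyp2F1 (K : fieldType) (a b c : K) : fps K :=
  fun n => poch a n * poch b n / ((n`!)%:R * poch c n).

(* Main.v *)
Require Import Defs.
From mathcomp Require Import all_boot all_order all_algebra.
From mathcomp Require Import reals ring.
From mathcomp.real_closed Require Import complex.

(** Since [(c-2)_4 = (c-2) (c-1) (c)_2], the first three products are
    [G = F(-a,-b-2,-c)] times [F + 2/(c-2) t F' + t^2 F''/((c-2)(c-1))] with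
    [F = F(a,b,c)], and the differential operator multiplies the n-th
    coefficient of [F] by [(c-2+n)(c-1+n)/((c-2)(c-1))]: it turns [F(a,b,c)]
    into [F(a,b,c-2)]. So the left-hand side is [y1 z1 + k y2 z2], where
      y1 = F(a,b,c-2)       and  y2 = t^(3-c) F(a-c+3,b-c+3,4-c)
    are the two Frobenius solutions at 0 of the hypergeometric equation with
    parameters [(a,b,c-2)], while
      z1 = F(-a,-b-2,-c)    and  z2 = t^(c+1) F(-a+c+1,-b+c-1,c+2)
    are those for [(-a,-b-2,-c)], an equation contiguous to the dual of the
    first one. For the right constant [k] this is the monodromy-invariant
    pairing of the two solution spaces, which is single-valued, regular at 0
    and 1, and of order [t^2] at infinity, hence a quadratic polynomial.

    The formal proof replaces monodromy by a recurrence. To a product of two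
    series [y = sum f_i t^(s+i)] and [z = sum g_j t^(-s+j)] attach the moments
    [M_e(n) = sum_(i+j=n) (s+i)^e f_i g_j], the coefficients of
    [((t d/dt)^e y) z]. The two hypergeometric equations, tested against 1 and
    against the exponent, give linear relations between the moments at [n+1]
    and at [n] ([moment_recP]); these do not mention [s], so they hold for the
    sum of the two products. As a system for [M_0, M_1, M_2] at [N = n+1] they
    have determinant proportional to [N (N-4) (N+c-3) (N-c-1)], which reflects
    the exponents 0, 4, 3-c, c+1 of the products [y z] at 0. As [c] is not an
    integer, the moments from order 5 on are determined by the previous ones,
    and [M_0 = 0] persists ([moment0_eq0]). Order 4 is the resonant one, where
    the value of [k] is what makes the coefficient vanish. The orders up to 4
    are identities between rational functions of [a], [b] and [c]. *)

Import GRing.Theory Num.Theory.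

Set Implicit Arguments.
Unset Strict Implicit.
Unset Printing Implicit Defensive.

Local Open Scope ring_scope.
Local Open Scope complex_scope.

(** * Pochhammer symbols and formal power series *)

Lemma poch0 (K : nzRingType) (a : K) : poch a 0 = 1.
Proof. exact: big_ord0. Qed.

Lemma pochS (K : nzRingType) (a : K) n : poch a n.+1 = poch a n * (a + n%:R).
Proof. exact: big_ord_recr. Qed.

Lemma pochSl (K : nzRingType) (a : K) n : poch a n.+1 = a * poch (a + 1) n.
Proof.
rewrite /poch big_ord_recl addr0; congr (_ * _).
by apply: eq_bigr => i _; rewrite /bump /= natrD addrA.
Qed.

Lemma fps_mul_monomial (K : nzRingType) (k : K) (m : nat) (f : fps K) (n : nat) :
  ((k *: 'X^m)%:S * f)%fps n = if (m <= n)%N then k * f (n - m)%N else 0.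
Proof.
rewrite /fps_mul /fps_of_poly; under eq_bigr do rewrite coefZ coefXn.
case: leqP => [le_mn|lt_nm].
  rewrite (bigD1 (Ordinal (le_mn : (m < n.+1)%N))) //= eqxx mulr1 big1 ?addr0 //.
  by move=> i ne_im; rewrite (negPf (ne_im : (i != m :> nat))) mulr0 mul0r.
rewrite big1 // => i _; rewrite ltn_eqF ?mulr0 ?mul0r //.
exact: leq_trans (ltn_ord i) lt_nm.
Qed.

Lemma fps_mulDl (K : nzRingType) (f g h : fps K) :
  ((f + g) * h =1 f * h + g * h)%fps.
Proof.
move=> n; rewrite /fps_mul /fps_add -big_split.
by apply: eq_bigr => i _; rewrite mulrDl.
Qed.

Lemma eq_fps_mull (K : nzRingType) (f g h : fps K) :
  f =1 g -> (f * h =1 g * h)%fps.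
Proof. by move=> eq_fg n; apply: eq_bigr => i _; rewrite eq_fg. Qed.

(** Reduces a linear consequence of two equations to a polynomial identity,
    to be checked by [ring]. *)
Lemma eq_lincomb2 (K : nzRingType) (k k' x y l r l' r' : K) :
  l = r -> l' = r' -> x - y = k * (l - r) + k' * (l' - r') -> x = y.
Proof. by move=> -> ->; rewrite !subrr !mulr0 addr0 => /subr0_eq. Qed.

(** * Moments of a product of two Frobenius series *)

Section Moments.
Variable K : fieldType.
Implicit Types (f g : fps K) (p : K -> K) (s : K).

(** The coefficients of [(p(theta) y) z] for [theta = t d/dt],
    [y = sum_i f_i t^(s+i)] and [z = sum_j g_j t^(-s+j)]: the exponents of [y]
    and [z] add up to integers, so that the product is a power series. *)
Definition theta_conv p s f g : fps K :=
  fun n => \sum_(i < n.+1) p (s + i%:R) * (f i * g (n - i)%N).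

Definition moment s f g (k : nat) : fps K := theta_conv (fun x => x ^+ k) s f g.

Lemma moment0E s f g : moment s f g 0 =1 (f * g)%fps.
Proof. by move=> n; apply: eq_bigr => i _; rewrite mul1r. Qed.

(** The Gauss hypergeometric equation
    [theta (theta + c - 1) y = t (theta + a) (theta + b) y]
    for [y = sum_i f_i t^(s+i)], coefficient by coefficient. The leading
    coefficient may vanish: then [s] need not be an exponent of the equation. *)
Definition gauss_eq (a b c s : K) f :=
  s * (s + c - 1) * f 0%N = 0 /\
  forall i : nat, (s + i%:R + 1) * (s + i%:R + c) * f i.+1
                = (s + i%:R + a) * (s + i%:R + b) * f i.

Lemma theta_conv_cubic p (q0 q1 q2 q3 : K) s f g n :
    (forall x, p x = q0 + q1 * x + q2 * x ^+ 2 + q3 * x ^+ 3) ->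
  theta_conv p s f g n
  = q0 * moment s f g 0 n + q1 * moment s f g 1 n
    + q2 * moment s f g 2 n + q3 * moment s f g 3 n.
Proof.
move=> p_cubic; rewrite /moment /theta_conv !mulr_sumr -!big_split /=.
by apply: eq_bigr => i _; rewrite p_cubic; ring.
Qed.

(** Inside a coefficient of [y z], the equation of [y] trades its left-hand
    side for [t] times [(theta + a) (theta + b) y]. The factor [t] lowers the
    total order by one, and an exponent [x] at the lower order stands for
    [x + 1] at the higher one. *)
Lemma theta_conv_gauss_l p a b c s f g n : gauss_eq a b c s f ->
  theta_conv (fun x => x * (x + c - 1) * p x) s f g n.+1
  = theta_conv (fun x => (x + a) * (x + b) * p (x + 1)) s f g n.
Proof.
move=> [f_init f_step]; rewrite /theta_conv big_ord_recl /= addr0.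
rewrite mulrA [_ * p s]mulrC -[p s * _ * _]mulrA f_init mulr0 mul0r add0r.
apply: eq_bigr => i _; rewrite /bump /= subSS.
have -> : s + (1 + i)%:R = s + i%:R + 1 by ring.
transitivity (p (s + i%:R + 1) * g (n - i)%N *
  ((s + i%:R + 1) * (s + i%:R + c) * f i.+1)); first by ring.
by rewrite f_step; ring.
Qed.

(** The same for the second factor, whose exponent is the total order minus
    that of the first; the argument of [p] is therefore not shifted. *)
Lemma theta_conv_gauss_r p a b c s f g n : gauss_eq a b c (- s) g ->
  theta_conv (fun x => (n.+1%:R - x) * (n.+1%:R - x + c - 1) * p x) s f g n.+1
  = theta_conv (fun x => (n%:R - x + a) * (n%:R - x + b) * p x) s f g n.
Proof.
move=> [g_init g_step]; rewrite /theta_conv big_ord_recr /= subnn.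
have -> : n.+1%:R - (s + n.+1%:R) = - s by ring.
rewrite [f _ * _]mulrC mulrA [_ * p _]mulrC -[p _ * _ * _]mulrA g_init.
rewrite mulr0 mul0r addr0.
apply: eq_bigr => i _; have le_in : (i <= n)%N by rewrite -ltnS.
rewrite subSn //; set j := (n - i)%N.
have -> : n%:R = i%:R + j%:R :> K by rewrite -natrD subnKC.
have -> : n.+1%:R = i%:R + j%:R + 1 :> K by rewrite -natrD subnKC // -natr1.
transitivity (p (s + i%:R) * f i * ((- s + j%:R + 1) * (- s + j%:R + c) * g j.+1)).
  by ring.
by rewrite g_step; ring.
Qed.

(** The relations on the moments implied by the two hypergeometric equations.
    The first comes from the equation of [y] alone. The others compare the two
    equations, tested against 1 and against the exponent [x] of [y]: at order
    [N] the quadratic terms of [x (x + c - 3)] and [(N - x) (N - x - c - 1)]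
    cancel in the difference, so that no moment beyond the second occurs. *)
Definition moment_rec (a b c : K) (M : nat -> fps K) := forall n : nat,
  [/\ M 2 n.+1 + (c - 3) * M 1%N n.+1
      = M 2 n + (a + b) * M 1%N n + a * b * M 0%N n,
      (2 * n%:R - 2) * M 1%N n.+1 - n.+1%:R * (n%:R - c) * M 0%N n.+1
      = (2 * n%:R - 2) * M 1%N n
        + (a * b - (n%:R - a) * (n%:R - b - 2)) * M 0%N n
    & (2 * n%:R - 2) * M 2 n.+1 - n.+1%:R * (n%:R - c) * M 1%N n.+1
      = (2 * n%:R - 1) * M 2 n
        + (a * b + a + b - (n%:R - a) * (n%:R - b - 2)) * M 1%N n
        + a * b * M 0%N n].

Lemma moment_recP a b c s f g :
    gauss_eq a b (c - 2) s f -> gauss_eq (- a) (- b - 2) (- c) (- s) g ->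
  moment_rec a b c (moment s f g).
Proof.
move=> f_eq g_eq n.
have := theta_conv_gauss_l (fun=> 1) g n f_eq.
have := theta_conv_gauss_r (fun=> 1) f n g_eq.
have := theta_conv_gauss_l id g n f_eq.
have := theta_conv_gauss_r id f n g_eq.
rewrite (@theta_conv_cubic _ 0 (n.+1%:R * (n%:R - c)) (- (2 * n%:R + 1 - c)) 1);
  last by move=> x; ring.
rewrite (@theta_conv_cubic _ 0 ((n%:R - a) * (n%:R - b - 2))
  (- (2 * n%:R - a - b - 2)) 1); last by move=> x; ring.
rewrite (@theta_conv_cubic _ 0 0 (c - 3) 1); last by move=> x; ring.
rewrite (@theta_conv_cubic _ (a * b) (a * b + a + b) (a + b + 1) 1);
  last by move=> x; ring.
rewrite (@theta_conv_cubic _ (n.+1%:R * (n%:R - c)) (- (2 * n%:R + 1 - c)) 1 0);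
  last by move=> x; ring.
rewrite (@theta_conv_cubic _ ((n%:R - a) * (n%:R - b - 2))
  (- (2 * n%:R - a - b - 2)) 1 0); last by move=> x; ring.
rewrite (@theta_conv_cubic _ 0 (c - 3) 1 0); last by move=> x; ring.
rewrite (@theta_conv_cubic _ (a * b) (a + b) 1 0); last by move=> x; ring.
(* [l] and [r] come from the first and the second equation, tested against
   1 (index 0) and against the exponent (index 1). *)
set M := moment s f g => r1 l1 r0 l0; split.
- by apply: (@eq_lincomb2 _ 1 0 _ _ _ _ _ _ l0 l0); ring.
- by apply: (@eq_lincomb2 _ 1 (-1) _ _ _ _ _ _ l0 r0); ring.
- by apply: (@eq_lincomb2 _ 1 (-1) _ _ _ _ _ _ l1 r1); ring.
Qed.

(** The relations are linear and free of the exponent [s]: two products with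
    different exponents may be added. *)
Lemma moment_recD a b c M M' : moment_rec a b c M -> moment_rec a b c M' ->
  moment_rec a b c (fun k => M k + M' k)%fps.
Proof.
move=> HM HM' n; rewrite /fps_add.
have [h1 h2 h3] := HM n; have [h1' h2' h3'] := HM' n; split.
- by apply: (@eq_lincomb2 _ 1 1 _ _ _ _ _ _ h1 h1'); ring.
- by apply: (@eq_lincomb2 _ 1 1 _ _ _ _ _ _ h2 h2'); ring.
- by apply: (@eq_lincomb2 _ 1 1 _ _ _ _ _ _ h3 h3'); ring.
Qed.

End Moments.

(** * Frobenius solutions of the hypergeometric equation *)

Section Frobenius.
Variable K : numFieldType.
Implicit Types (a b c d k s : K) (f : fps K).

Lemma poch_neq0 c n : (forall i : nat, c + i%:R != 0) -> poch c n != 0.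
Proof. by move=> c_neq; apply/prodf_neq0 => i _. Qed.

Lemma hyp2F1S a b c n : (forall i : nat, c + i%:R != 0) ->
  n.+1%:R * (c + n%:R) * hyp2F1 a b c n.+1 = (a + n%:R) * (b + n%:R) * hyp2F1 a b c n.
Proof.
move=> c_neq; rewrite /hyp2F1 !pochS factS natrM.
have fact_neq : (n`!)%:R != 0 :> K by rewrite pnatr_eq0 -lt0n fact_gt0.
by field; rewrite c_neq fact_neq poch_neq0 //= addrC natr1 pnatr_eq0.
Qed.

(** The second hypothesis says that [s] is an exponent of the equation at 0
    and that the other one is [s + 1 - d]; it covers both [s = 0, d = c] and
    [s = 1 - c, d = 2 - c]. *)
Lemma gauss_eq_hyp2F1 a b c d s : (forall i : nat, d + i%:R != 0) ->
    (forall x, (s + x) * (s + x + c - 1) = x * (x + d - 1)) ->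
  gauss_eq a b c s (hyp2F1 (a + s) (b + s) d).
Proof.
move=> d_neq exponent; split=> [|i].
  by have := exponent 0; rewrite addr0 mul0r => ->; rewrite mul0r.
have := hyp2F1S (a + s) (b + s) i d_neq.
have -> : (s + i%:R + 1) * (s + i%:R + c) = i.+1%:R * (d + i%:R).
  have e := exponent i.+1%:R.
  by apply: (@eq_lincomb2 _ 1 0 _ _ _ _ _ _ e e); ring.
by move=> ->; ring.
Qed.

(** A factor [t^m] is absorbed by the exponent: the series [t^(s-m) (t^m f)]
    is again [t^s f]. This aligns the orders of the two products. *)
Lemma gauss_eq_monomial a b c s k m f : gauss_eq a b c s f ->
  gauss_eq a b c (s - m%:R) ((k *: 'X^m)%:S * f)%fps.
Proof.
move=> [f_init f_step]; split=> [|i]; rewrite !fps_mul_monomial.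
  rewrite leqn0 sub0n; case: eqP => [->|_]; last by rewrite mulr0.
  by rewrite subr0 mulrCA f_init mulr0.
case: (ltngtP m i.+1) => [|lt_im|->]; last 2 first.
- by rewrite leqNgt ltnW //= !mulr0.
- rewrite ltnn subnn mulr0 -natr1.
  have -> : s - (i%:R + 1) + i%:R + 1 = s by ring.
  have -> : s - (i%:R + 1) + i%:R + c = s + c - 1 by ring.
  by rewrite mulrCA f_init mulr0.
rewrite ltnS => le_mi; rewrite le_mi subSn // mulrCA.
have -> : s - m%:R + i%:R = s + (i - m)%:R by rewrite natrB //; ring.
by rewrite f_step mulrCA.
Qed.

End Frobenius.

(** * Propagation of the vanishing of the coefficients *)

Section Vanishing.
Variables (K : numFieldType) (a b c : K).
Hypothesis c_nint : forall m : int, c + m%:~R != 0.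

(** When the zeroth moment vanishes, the relations force the first moment to
    be constant in the order and the second one to be an affine function of
    the order, called [slope], times the first. The induction carries the
    latter along. Order 4 is an assumption, since the determinant of the
    system vanishes there. *)
Lemma moment0_eq0 (T : nat -> fps K) : moment_rec a b c T ->
    T 0%N 3%N = 0 -> T 0%N 4%N = 0 -> T 2%N 3%N = (3 + 2 * a) * T 1%N 3%N ->
  forall n, (3 <= n)%N -> T 0%N n = 0.
Proof.
move=> T_rec T03 T04 T23 n le3n.
pose slope n : K := (a + b + 3 - c) * (n%:R - 3) + 3 + 2 * a.
suff [] : T 0%N n = 0 /\ T 2%N n = slope n * T 1%N n by [].
elim: n le3n => // n IHn; rewrite ltnS leq_eqVlt => /predU1P[<- {n IHn}|lt2n].
  by split; rewrite // T23 /slope; ring.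
have [{IHn} T0n T2n] := IHn lt2n; have [e1 e2 e3] := T_rec n.
have n1_neq : n.+1%:R != 0 :> K by rewrite pnatr_eq0.
have nc_neq : n%:R - c != 0.
  by rewrite -opprB oppr_eq0; have := c_nint (- n%:Z); rewrite mulrNz.
have n2_neq : 2 * n%:R - 2 != 0 :> K.
  rewrite -[X in _ - X]mulr1 -mulrBr mulf_neq0 ?pnatr_eq0 //.
  by rewrite subr_eq0 pnatr_eq1 gtn_eqF // ltnW.
(* Elimination of the second moment between the first and third relations,
   neither of which involves the zeroth moment at order [n + 1]. *)
have jump : (n.+1%:R - 4) * (n.+1%:R + c - 3) * (T 1%N n.+1 - T 1%N n) = 0.
  rewrite T0n T2n /slope in e1 e3.
  apply: (@eq_lincomb2 _ (2 * n%:R - 2) (-1) _ _ _ _ _ _ e1 e3).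
  by ring.
have T0n1 : T 0%N n.+1 = 0.
  move: lt2n; rewrite leq_eqVlt => /predU1P[<- //|lt3n].
  have T1n1 : T 1%N n.+1 = T 1%N n.
    move/eqP: jump; rewrite !mulf_eq0 subr_eq0 => /orP[/orP[]|/eqP/subr0_eq //].
      by rewrite eqr_nat eqSS => /eqP n3; rewrite n3 in lt3n.
    by have := c_nint (n.+1%:Z - 3); rewrite intrB addrCA addrA => /negPf->.
  move/eqP: e2; rewrite T1n1 T0n mulr0 addr0.
  rewrite -subr_eq0 addrAC subrr add0r oppr_eq0 !mulf_eq0.
  by rewrite (negPf n1_neq) (negPf nc_neq) => /eqP.
have T1n1 : T 1%N n.+1 = T 1%N n.
  by apply: (mulfI n2_neq); move: e2; rewrite T0n1 T0n !mulr0 subr0 addr0.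
split=> //; rewrite T0n T1n1 T2n /slope in e1 *.
by apply: (@eq_lincomb2 _ 1 0 _ _ _ _ _ _ e1 e1); ring.
Qed.

End Vanishing.

(** * Lowering the third parameter *)

Section Contiguity.
Variables (K : numFieldType) (a b c : K).
Hypothesis c_nint : forall m : int, c + m%:~R != 0.

Lemma hyp2F1_derivative (a' b' c' : K) n : (forall i : nat, c' + i%:R != 0) ->
  a' * b' / c' * hyp2F1 (a' + 1) (b' + 1) (c' + 1) n
  = n.+1%:R * hyp2F1 a' b' c' n.+1.
Proof.
move=> c_neq; rewrite /hyp2F1 !pochSl factS natrM.
have fact_neq : (n`!)%:R != 0 :> K by rewrite pnatr_eq0 -lt0n fact_gt0.
have := poch_neq0 n.+1 c_neq; rewrite pochSl mulf_eq0 negb_or => /andP[c0 c1].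
by field; rewrite c0 c1 fact_neq addrC natr1 pnatr_eq0.
Qed.

Lemma hyp2F1_lower_c n :
  (c - 2) * (c - 1) * hyp2F1 a b (c - 2) n
  = (c - 2 + n%:R) * (c - 1 + n%:R) * hyp2F1 a b c n.
Proof.
have c_neq (m : int) (i : nat) : c + m%:~R + i%:R != 0.
  by rewrite -addrA pmulrn -intrD.
have fact_neq : (n`!)%:R != 0 :> K by rewrite pnatr_eq0 -lt0n fact_gt0.
have p0 : poch c n != 0 by apply: poch_neq0 => i; have := c_neq 0 i; rewrite addr0.
have p2 : poch (c - 2) n != 0 by apply: poch_neq0 => i; exact: c_neq (-2) i.
have : poch (c - 2) n.+2 = (c - 2) * (c - 1) * poch c n.
  rewrite !pochSl mulrA; congr (_ * _ * poch _ _); ring.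
rewrite !pochS -natr1 => e; rewrite /hyp2F1.
apply: (mulIf p0); apply: (mulIf p2).
(* [e] compares two expressions of [(c-2)_(n+2)]; the factor clears it
   against the common part of the two coefficients. *)
apply: (@eq_lincomb2 _ (- (poch a n * poch b n / n`!%:R)) 0 _ _ _ _ _ _ e e).
by field; rewrite fact_neq p0 p2.
Qed.

(** The series on the left is
    [F + 2/(c-2) t F' + t^2 F''/((c-2)(c-1))] with [F = F(a,b,c)]. *)
Lemma hyp2F1_lower_c_expansion n :
  (hyp2F1 a b c
   + ((2 * a * b / (c * (c - 2))) *: 'X)%:S * hyp2F1 (a + 1) (b + 1) (c + 1)
   + ((poch a 2 * poch b 2 / poch (c - 2) 4) *: 'X^2)%:S
       * hyp2F1 (a + 2) (b + 2) (c + 2))%fps n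
  = hyp2F1 a b (c - 2) n.
Proof.
have c_neq (m : int) (i : nat) : c + m%:~R + i%:R != 0.
  by rewrite -addrA pmulrn -intrD.
have c0 i : c + i%:R != 0 by have := c_neq 0 i; rewrite addr0.
have c1 i : c + 1 + i%:R != 0 by exact: c_neq 1 i.
have c0n : c != 0 by have := c0 0%N; rewrite addr0.
have c1n : c + 1 != 0 := c0 1%N.
have cm2 : c - 2 != 0 := c_nint (-2).
have cm1 : c - 1 != 0 := c_nint (-1).
have d1 i := hyp2F1_derivative a b i c0.
have d2 i := hyp2F1_derivative (a + 1) (b + 1) i c1.
have add2 (x : K) : x + 2 = x + 1 + 1 by ring.
rewrite /fps_add -['X]expr1 !fps_mul_monomial.
apply: (mulfI (mulf_neq0 cm2 cm1)); rewrite hyp2F1_lower_c.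
case: n => [|n]; first by rewrite /=; ring.
rewrite /= subSS subn0.
have -> : 2 * a * b / (c * (c - 2)) * hyp2F1 (a + 1) (b + 1) (c + 1) n
   = 2 / (c - 2) * (n.+1%:R * hyp2F1 a b c n.+1).
  by rewrite -d1; field; rewrite c0n cm2.
case: n => [|n]; first by rewrite /=; field.
rewrite /= 2!subSS subn0 !add2.
have -> : poch a 2 * poch b 2 / poch (c - 2) 4
     * hyp2F1 (a + 1 + 1) (b + 1 + 1) (c + 1 + 1) n
   = ((c - 2) * (c - 1))^-1 * n.+1%:R * (n.+2%:R * hyp2F1 a b c n.+2).
  transitivity (((c - 2) * (c - 1))^-1 *
    (a * b / c * (n.+1%:R * hyp2F1 (a + 1) (b + 1) (c + 1) n.+1))).
    rewrite -d2 !pochS !poch0; field.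
    by rewrite c1n c0n cm1 cm2.
  by rewrite [a * b / c * _]mulrCA d1; ring.
by field; rewrite cm1 cm2.
Qed.

End Contiguity.

(** * The pairing of the two solution spaces *)

Section Identity.
Variables (K : numFieldType) (a b c : K).
Hypothesis c_nint : forall m : int, c + m%:~R != 0.

Let shifted_c_neq0 (m : int) (x : K) : c + m%:~R = x \/ c + m%:~R = - x -> x != 0.
Proof. by have := c_nint m => c_m [<- //|e]; rewrite -oppr_eq0 -e. Qed.

(* Closes the side conditions of [field], which are of the form
   [c + m != 0] or [- c + m != 0] for integers [m] between -3 and 5. *)
Ltac c_nonzero m := by apply: (@shifted_c_neq0 m); (left; ring) || (right; ring).
Ltac c_nonzeros := repeat (apply/andP; split);
  first [ c_nonzero (0 : int) | c_nonzero (1 : int) | c_nonzero (2 : int)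
        | c_nonzero (3 : int) | c_nonzero (4 : int) | c_nonzero (5 : int)
        | c_nonzero (-1 : int) | c_nonzero (-2 : int) | c_nonzero (-3 : int) ].

Let k := a * poch b 3 * poch (a - c) 3 * (c - b - 2) / (poch (c - 3) 4 * poch (c - 2) 4).
Let f1 := hyp2F1 a b (c - 2).
Let g1 := hyp2F1 (- a) (- b - 2) (- c).
Let f2 := ((k *: 'X^4)%:S * hyp2F1 (a - c + 3) (b - c + 3) (4 - c))%fps.
Let g2 := hyp2F1 (- a + c + 1) (- b + c - 1) (c + 2).

(** The moments of [y1 z1 + k y2 z2]. Both the constant [k] and the factor
    [t^4] relating [t^(3-c) t^(c+1)] to a power series starting at order 0 are
    put into [f2], whose initial exponent becomes [3 - c - 4]. *)
Definition pairing (e : nat) : fps K :=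
  (moment 0 f1 g1 e + moment (- 1 - c) f2 g2 e)%fps.

Lemma pairing_rec : moment_rec a b c pairing.
Proof.
apply: moment_recD; apply: moment_recP.
- rewrite /f1 -[a in hyp2F1 a]addr0 -[b in hyp2F1 _ b]addr0.
  apply: gauss_eq_hyp2F1 => [i|x]; last by ring.
  by apply: (@shifted_c_neq0 (i%:Z - 2)); left; rewrite intrB; ring.
- rewrite oppr0 /g1 -[X in hyp2F1 X]addr0 -[X in hyp2F1 _ X]addr0.
  apply: gauss_eq_hyp2F1 => [i|x]; last by ring.
  apply: (@shifted_c_neq0 (- i%:Z)); right; rewrite mulrNz; ring.
- have -> : - 1 - c = 3 - c - 4%:R by ring.
  apply: gauss_eq_monomial.
  have -> : a - c + 3 = a + (3 - c) by ring.
  have -> : b - c + 3 = b + (3 - c) by ring.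
  apply: gauss_eq_hyp2F1 => [i|x]; last by ring.
  apply: (@shifted_c_neq0 (- i%:Z - 4)); right; rewrite intrB mulrNz; ring.
- rewrite /g2.
  have -> : - a + c + 1 = - a + - (- 1 - c) by ring.
  have -> : - b + c - 1 = - b - 2 + - (- 1 - c) by ring.
  apply: gauss_eq_hyp2F1 => [i|x]; last by ring.
  by apply: (@shifted_c_neq0 (i%:Z + 2)); left; rewrite intrD; ring.
Qed.

Ltac expand_pairing :=
  rewrite /pairing /fps_add /moment /theta_conv !big_ord_recr !big_ord0 /=
  /f2 !fps_mul_monomial /= /f1 /g1 /g2 /k /hyp2F1 ?pochS ?poch0 ?factS ?fact0.

Lemma pairing00 : pairing 0 0 = 1.
Proof. expand_pairing. by field. Qed.

Lemma pairing01 : pairing 0 1 = 2 * a * (b - c + 2) / (c * (c - 2)).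
Proof. expand_pairing. by field; c_nonzeros. Qed.

Lemma pairing02 : pairing 0 2 = a * (a - b - 1) * (c - b - 2) / ((c - 2) * (c - 1) * c).
Proof. expand_pairing. by field; c_nonzeros. Qed.

Lemma pairing03 : pairing 0 3 = 0.
Proof. expand_pairing. by field; c_nonzeros. Qed.

Lemma pairing23 : pairing 2 3 = (3 + 2 * a) * pairing 1 3.
Proof. expand_pairing. by field; c_nonzeros. Qed.

(** The resonant order, where the value of [k] enters. *)
Lemma pairing04 : pairing 0 4 = 0.
Proof. expand_pairing. by field; c_nonzeros. Qed.

Lemma hyp2F1_pairing :
  (f1 * g1 + f2 * g2)%fps =1
  (1 + (2 * a * (b - c + 2) / (c * (c - 2))) *: 'X
     + (a * (a - b - 1) * (c - b - 2) / ((c - 2) * (c - 1) * c)) *: 'X^2)%:S%fps.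
Proof.
move=> n; transitivity (pairing 0 n).
  by rewrite /pairing /fps_add !moment0E.
rewrite /fps_of_poly !coefD !coefZ coef1 coefX coefXn.
case: n => [|[|[|n]]] /=.
- by rewrite pairing00 !mulr0 !addr0.
- by rewrite pairing01 mulr1 mulr0 add0r addr0.
- by rewrite pairing02 mulr1 mulr0 !add0r.
rewrite !mulr0 !addr0; apply: (moment0_eq0 c_nint pairing_rec) => //.
- exact: pairing03.
- exact: pairing04.
- exact: pairing23.
Qed.

End Identity.

Theorem lemma3p9 (R : realType) (a b c : R[i])
    (hc : forall m : int, c <> m%:~R) :
  ( hyp2F1 a b c * hyp2F1 (- a) (- b - 2) (- c)
  + ((2 * a * b / (c * (c - 2))) *: 'X)%:S
      * hyp2F1 (a + 1) (b + 1) (c + 1) * hyp2F1 (- a) (- b - 2) (- c)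
  + ((poch a 2 * poch b 2 / poch (c - 2) 4) *: 'X^2)%:S
      * hyp2F1 (a + 2) (b + 2) (c + 2) * hyp2F1 (- a) (- b - 2) (- c)
  + ((a * poch b 3 * poch (a - c) 3 * (c - b - 2)
        / (poch (c - 3) 4 * poch (c - 2) 4)) *: 'X^4)%:S
      * hyp2F1 (a - c + 3) (b - c + 3) (4 - c)
      * hyp2F1 (- a + c + 1) (- b + c - 1) (c + 2))%fps
  =1
  ( 1 + (2 * a * (b - c + 2) / (c * (c - 2))) *: 'X
      + (a * (a - b - 1) * (c - b - 2) / ((c - 2) * (c - 1) * c)) *: 'X^2 )%:S%fps.
Proof.
have c_nint (m : int) : c + m%:~R != 0.
  by apply/eqP => /eqP; rewrite addr_eq0 -mulrNz => /eqP; exact: hc.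
move=> n; rewrite -hyp2F1_pairing // /fps_add; congr (_ + _).
rewrite -(eq_fps_mull _ (hyp2F1_lower_c_expansion a b c_nint)).
by rewrite !fps_mulDl /fps_add !fps_mulDl.
Qed.
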